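(* Let $(V,\omega,\mu)$ be a connected locally finite weighted graph, let $\Omega\subset V$ be a nonempty finite subset, let $1<p<\infty$, and let $w:\Omega\to\mathbb{R}$. Assume that the Dirichlet problem $$-\Delta_p^\omega u(x)=w(x)|u(x)|^{p-2}u(x)\quad (x\in\Omega),\qquad u(x)=0\quad (x\in V\setminus\Omega)$$ admits a nontrivial solution $u\in X_V(\Omega)$ (i.e. $u\not\equiv 0$). Then $$\frac{1}{\mathcal{R}_p(\Omega)}\le \|w_+\|_{\ell^1(\Omega,\mu)}.$$ Moreover, for every $1<s<\infty$, $$\frac{1}{\mathcal{R}_{p,s}(\Omega)}\le \|w_+\|_{\ell^s(\Omega,\mu)}.$$
   Context: A weighted graph is a triple $(V,\omega,\mu)$ where $V$ is a countably infinite set, $\mu:V\to(0,\infty)$, and $\omega:V\times V\to[0,\infty)$ satisfies $\omega_{xy}=\omega_{yx}$ and $\omega_{xx}=0$. Write $x\sim y$ if $\omega_{xy}>0$. The graph is locally finite if every vertex has finitely many neighbours, and connected if any two vertices are joined by a finite path $x=x_0\sim x_1\sim\cdots\sim x_m=y$. For a nonempty finite $\Omega\subset V$, $X_V(\Omega)=\{u:V\to\mathbb{R}: u=0 \text{ in } V\setminus\Omega\}$. For $1<p<\infty$, the $p$-energy is $E_p(u)=\frac12\sum_{x,y\in V}\omega_{xy}|u(y)-u(x)|^p$ (a finite quantity for $u\in X_V(\Omega)$). The discrete $p$-Laplacian is $$\Delta_p^\omega u(x)=\frac{1}{\mu(x)}\sum_{y\sim x}\omega_{xy}|u(y)-u(x)|^{p-2}(u(y)-u(x)),$$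 with the convention $|t|^{p-2}t=0$ at $t=0$. For $1\le r<\infty$, $\|u\|_{\ell^r(\Omega,\mu)}=\left(\sum_{x\in\Omega}\mu(x)|u(x)|^r\right)^{1/r}$. The positive part is $w_+(x)=\max\{w(x),0\}$. For $x\in\Omega$, the point $p$-capacity is $\operatorname{Cap}_p(x,\Omega)=\inf\{E_p(\varphi):\varphi\in X_V(\Omega),\ \varphi(x)=1\}$, which lies in $(0,\infty)$. The capacitary radii are $$\mathcal{R}_p(\Omega)=\max_{x\in\Omega}\operatorname{Cap}_p(x,\Omega)^{-1},\qquad \mathcal{R}_{p,s}(\Omega)=\max_{u\in X_V(\Omega),\,u\not\equiv0}\frac{\|u\|_{\ell^{ps'}(\Omega,\mu)}^p}{E_p(u)}\quad(1<s<\infty),$$ where $s'=s/(s-1)$; the latter maximum is attained. *)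

(* Defs.v *)
From HB Require Import structures.
From mathcomp Require Import all_boot all_order all_algebra finmap.
From mathcomp Require Import all_classical all_reals all_analysis.
Set Implicit Arguments.
Unset Strict Implicit.
Unset Printing Implicit Defensive.
Import Order.TTheory GRing.Theory Num.Theory.
Local Open Scope classical_set_scope.
Local Open Scope ring_scope.

Record weighted_graph (R : realType) (V : choiceType) := WeightedGraph {
  mu : V -> R;
  omega : V -> V -> R;
  vertices_countably_infinite : ([set: V] #= [set: nat])%card;
  mu_gt0 : forall x, 0 < mu x;
  omega_ge0 : forall x y, 0 <= omega x y;
  omega_sym : forall x y, omega x y = omega y x;
  omega_diag : forall x, omega x x = 0 }.

Section Graph.
Context {R : realType} {V : choiceType} (G : weighted_graph R V).

Definition adj : rel V := fun x y => 0 < omega G x y.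

Definition neighbors (x : V) : set V := [set y | adj x y].

Definition locally_finite : Prop := forall x, finite_set (neighbors x).

Definition graph_connected : Prop :=
  forall x y, exists s : seq V, path adj x s /\ last x s = y.

Definition X_V (Omega : {fset V}) : set (V -> R) :=
  [set u | forall x, x \notin Omega -> u x = 0].

(* Valued in \bar R because the sum has infinitely many terms for general u. *)
Definition energy (p : R) (u : V -> R) : \bar R :=
  ((2^-1 : R)%:E *
   \esum_(z in [set: V * V]) (omega G z.1 z.2 * `|u z.2 - u z.1| `^ p)%:E)%E.

(* t |-> |t|^(p-2) t; the value at t = 0 is 0 for every p, thanks to the
   factor t. *)
Definition signed_pow (p t : R) : R := `|t| `^ (p - 2) * t.

(* The sum over \in is a finite-support sum: it is the genuine sum over the
   neighbors of x when the graph is locally finite. *)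
Definition p_laplacian (p : R) (u : V -> R) (x : V) : R :=
  (mu G x)^-1 *
  \sum_(y \in neighbors x) omega G x y * signed_pow p (u y - u x).

Definition lnorm (Omega : {fset V}) (r : R) (f : Omega -> R) : R :=
  (\sum_(x : Omega) mu G (val x) * `|f x| `^ r) `^ r^-1.

Definition pos_part (T : Type) (f : T -> R) : T -> R :=
  fun x => Num.max (f x) 0.

Definition dirichlet_solution (p : R) (Omega : {fset V}) (w : Omega -> R)
    (u : V -> R) : Prop :=
  X_V Omega u /\
  forall x : Omega,
    - p_laplacian p u (val x) = w x * signed_pow p (u (val x)).

Definition point_capacity (p : R) (x : V) (Omega : {fset V}) : \bar R :=
  ereal_inf [set energy p phi | phi in [set phi | X_V Omega phi /\ phi x = 1]].

Definition cap_radius (p : R) (Omega : {fset V}) : \bar R :=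
  \big[maxe/-oo%E]_(x : Omega) ((point_capacity p (val x) Omega)^-1)%E.

Definition conj_exponent (s : R) : R := s / (s - 1).

(* The supremum is attained (Omega is finite), so this is a maximum. *)
Definition cap_radius_s (p s : R) (Omega : {fset V}) : \bar R :=
  ereal_sup
    [set ((lnorm (p * conj_exponent s) (fun x : Omega => u (val x)) `^ p)%:E
            / energy p u)%E
    | u in [set u | X_V Omega u /\ exists x, u x != 0]].

End Graph.

(* Main.v *)
Require Import Defs.
From mathcomp Require Import all_boot all_order all_algebra finmap.
From mathcomp Require Import all_classical all_reals all_analysis.
From mathcomp Require Import ring.
Import Order.TTheory GRing.Theory Num.Theory.
Local Open Scope classical_set_scope.
Local Open Scope ring_scope.

(** Testing the equation [- Delta_p u = w |u|^(p-2) u] against [u] itself and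
    summing by parts ([green_formula]) gives
    [E_p(u) = \sum_Omega mu w |u|^p <= \sum_Omega mu w_+ |u|^p].
    The two bounds differ only in how [|u|^p] is separated from [w_+].

    For the first, choose [o] maximizing [|u|] on [Omega]; dividing by
    [|u(o)|^p], the right-hand side becomes at most the 1-norm of [w_+], while
    the left-hand side is the energy of [u / u(o)], a competitor for the
    capacity of [o] ([point_capacity_le]).  So some point of [Omega] has
    capacity at most [||w_+||_1].

    For the second, Hölder's inequality ([lnorm_hoelder]) bounds the right-hand
    side by [||w_+||_s ||u||_(p s')^p], which says that the quotient defining
    the capacitary radius is, at [u], at least [1 / ||w_+||_s].

    The energy is a sum over infinitely many pairs; since [u] is supported in
    [Omega] and vertices have finitely many neighbors, it reduces to a double
    sum over a finite set [N] containing [Omega] and all its neighbors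
    ([energyE]), where summation by parts is an exchange of finite sums. *)

(** * Real inequalities *)

Lemma signed_powN (R : realType) (p t : R) :
  signed_pow p (- t) = - signed_pow p t.
Proof. by rewrite /signed_pow normrN mulrN. Qed.

Lemma signed_pow_mulr (R : realType) (p t : R) :
  1 < p -> signed_pow p t * t = `|t| `^ p.
Proof.
move=> p1; have [->|t0] := eqVneq t 0.
  by rewrite mulr0 normr0 powR0// gt_eqF// (lt_trans ltr01).
have nt0 : 0 < `|t| by rewrite normr_gt0.
rewrite /signed_pow -mulrA -expr2 -real_normK ?num_real//.
by rewrite -powR_mulrn// -powRD ?subrK// (gt_eqF nt0) implybT.
Qed.

(** Hölder's inequality for a finite sum with weights [m], by Young's inequality
    applied to [a] and [b] normalized in their respective norms; if one of the
    norms vanishes, so does every term on the left. *)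
Lemma hoelder_sum {R : realType} {I : finType} {m a b : I -> R} {s t : R} :
  (forall i, 0 <= m i) -> (forall i, 0 <= a i) -> (forall i, 0 <= b i) ->
  0 < s -> 0 < t -> s^-1 + t^-1 = 1 ->
  \sum_i m i * (a i * b i) <=
  (\sum_i m i * a i `^ s) `^ s^-1 * (\sum_i m i * b i `^ t) `^ t^-1.
Proof.
move=> m0 a0 b0 s0 t0 st.
have mass0 (c : I -> R) r i : \sum_i m i * c i `^ r = 0 -> m i * c i = 0.
  move=> /eqP; rewrite psumr_eq0 => [/allP /(_ i)|j _]; last first.
    by rewrite mulr_ge0 ?powR_ge0.
  rewrite mem_index_enum => /(_ isT) /implyP /(_ isT).
  by rewrite mulf_eq0 => /orP[/eqP->|/eqP/powR_eq0_eq0->];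
    rewrite ?mul0r ?mulr0.
set A := \sum_i m i * a i `^ s; set B := \sum_i m i * b i `^ t.
have ge0A : 0 <= A by apply: sumr_ge0 => i _; rewrite mulr_ge0 ?powR_ge0.
have ge0B : 0 <= B by apply: sumr_ge0 => i _; rewrite mulr_ge0 ?powR_ge0.
have [A0|A0] := eqVneq A 0.
  rewrite big1 ?mulr_ge0 ?powR_ge0// => i _.
  by rewrite mulrA (mass0 _ _ i A0) mul0r.
have [B0|B0] := eqVneq B 0.
  rewrite big1 ?mulr_ge0 ?powR_ge0// => i _.
  by rewrite mulrCA (mass0 _ _ i B0) mulr0.
have {}A0 : 0 < A by rewrite lt_def A0.
have {}B0 : 0 < B by rewrite lt_def B0.
set x := A `^ s^-1; set y := B `^ t^-1.
have x0 : 0 < x by exact: powR_gt0.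
have y0 : 0 < y by exact: powR_gt0.
have xs : x `^ s = A by rewrite -powRrM mulVf ?gt_eqF// powRr1.
have yt : y `^ t = B by rewrite -powRrM mulVf ?gt_eqF// powRr1.
have powV (c z r : R) : 0 <= c -> 0 < z -> (c / z) `^ r = c `^ r / z `^ r.
  move=> c0 z0; rewrite powRM ?invr_ge0 ?(ltW z0)//; congr (_ * _).
  by rewrite -powR_inv1 ?(ltW z0)// -powRrM mulN1r powRN.
(* The norms now enter only through their signs and [x ^ s = A], [y ^ t = B]. *)
clearbody x y.
suff : \sum_i m i * (a i / x * (b i / y)) <= 1.
  rewrite -(ler_pM2l (mulr_gt0 x0 y0)) mulr1; apply: le_trans.
  rewrite mulr_sumr le_eqVlt; apply/orP; left; apply/eqP/eq_bigr => i _.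
  by field; rewrite !gt_eqF.
apply: (@le_trans _ _
    (\sum_i (m i * a i `^ s * (A^-1 / s) + m i * b i `^ t * (B^-1 / t)))).
  apply: ler_sum => i _.
  apply: (le_trans (ler_wpM2l (m0 i) (@conjugate_powR _ _ _ s t _ _ s0 t0 st))).
  - by rewrite divr_ge0 ?(ltW x0).
  - by rewrite divr_ge0 ?(ltW y0).
  by rewrite !powV// xs yt mulrDr !mulrA.
rewrite big_split/= -!mulr_suml -/A -/B !mulrA !divff ?gt_eqF//.
by rewrite !mul1r st.
Qed.

(** * The energy as a finite sum, and summation by parts *)

Section FiniteEnergy.
Context {R : realType} {V : choiceType} {G : weighted_graph R V}.

(** Any finite superset of the closed neighborhood of [Omega] serves as a domain
    of summation, so only this inclusion is recorded. *)
Definition closed_star (Omega N : {fset V}) : Prop :=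
  {subset Omega <= N} /\
  forall x y, x \in Omega -> adj G x y -> y \in N.

Lemma closed_star_exists (Omega : {fset V}) :
  locally_finite G -> exists N, closed_star Omega N.
Proof.
move=> Gfin.
have /finite_fsetP[N NE] :
    finite_set ([set` Omega] `|` \bigcup_(x in [set` Omega]) neighbors G x).
  rewrite finite_setU; split; first exact: finite_fset.
  by apply: bigcup_finite => [|x _]; [exact: finite_fset|exact: Gfin].
exists N; split=> [x xO|x y xO xy].
  by have : [set` N] x by rewrite -NE; left.
by have : [set` N] y by rewrite -NE; right; exists x.
Qed.

Lemma nadj_omega0 x y : ~~ adj G x y -> omega G x y = 0.
Proof.
rewrite /adj -leNgt => h; apply/eqP.
by rewrite eq_le h omega_ge0.
Qed.

Context {Omega N : {fset V}} {p : R}.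
Hypotheses (starN : closed_star Omega N) (p1 : 1 < p).

(** An edge with an end in [Omega] has both ends in [N]; on any other edge, [u]
    vanishes at both ends. *)
Lemma edge_out_star u x y : X_V Omega u -> ~~ ((x \in N) && (y \in N)) ->
  omega G x y * `|u y - u x| `^ p = 0.
Proof.
move=> uO; case: starN => ON nN xyN.
have [adjxy|/nadj_omega0->] := boolP (adj G x y); last by rewrite mul0r.
have adjyx : adj G y x by rewrite /adj omega_sym.
have [xO|xO] := boolP (x \in Omega).
  by move: xyN; rewrite (ON x)// (nN x y).
have [yO|yO] := boolP (y \in Omega).
  by move: xyN; rewrite (ON y)// (nN y x).
by rewrite !uO// subrr normr0 powR0 ?mulr0// gt_eqF// (lt_trans ltr01).
Qed.

Lemma energyE u : X_V Omega u ->
  energy G p u =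
  (2^-1 * \sum_(x <- N) \sum_(y <- N) omega G x y * `|u y - u x| `^ p)%:E.
Proof.
move=> uO; rewrite /energy EFinM; congr (_ * _)%E.
pose r := [seq (x, y) | x <- N, y <- N].
have ur : uniq r by apply: allpairs_uniq => // -[x y] [x' y'].
have rE x y : ((x, y) \in r) = (x \in N) && (y \in N).
  apply/allpairsP/andP => [[[x' y'] /= [? ? [-> ->]]]|[xN yN]] //.
  by exists (x, y).
have F0 (z : V * V) : 0 <= omega G z.1 z.2 * `|u z.2 - u z.1| `^ p.
  by rewrite mulr_ge0 ?omega_ge0 ?powR_ge0.
transitivity (\esum_(z in [set` r])
    (omega G z.1 z.2 * `|u z.2 - u z.1| `^ p)%:E)%E.
  rewrite [RHS]esum_mkcond; apply: eq_esum => -[x y] _ /=.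
  rewrite mem_setE rE; case: ifPn => // /edge_out_star -> //.
rewrite esum_fset; [|exact: finite_seq|by move=> z _; rewrite lee_fin].
by rewrite -fsbig_seq// sumEFin big_allpairs.
Qed.

Lemma energyZ (c : R) u : X_V Omega u ->
  energy G p (fun x => c * u x) = ((`|c| `^ p)%:E * energy G p u)%E.
Proof.
move=> uO; rewrite !energyE//; last by move=> x xO; rewrite uO// mulr0.
rewrite -EFinM; congr EFin; rewrite [RHS]mulrCA; congr (_ * _).
rewrite mulr_sumr.
apply: eq_bigr => x _; rewrite mulr_sumr; apply: eq_bigr => y _.
by rewrite -mulrBr normrM powRM// mulrCA.
Qed.

Lemma p_laplacianE u x : x \in Omega ->
  mu G x * p_laplacian G p u x =
  \sum_(y <- N) omega G x y * signed_pow p (u y - u x).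
Proof.
case: starN => _ nN xO.
rewrite /p_laplacian mulVKf ?gt_eqF ?mu_gt0//.
apply: fsbig_fwiden => [y||y [_ /= /negP]] //=; first exact: nN.
by move=> /nadj_omega0->; rewrite mul0r.
Qed.

(** Writing [|d|^p] as [signed_pow p d * d] with [d = u y - u x] splits the double
    sum into its [u y] and [u x] parts, which coincide by the symmetry of the
    weights and the oddness of [signed_pow]; this absorbs the factor [1/2].
    The outer sum then shrinks to [Omega], where [u] lives. *)
Lemma green_formula u : X_V Omega u ->
  energy G p u =
  (\sum_(x : Omega) mu G (val x) * (- p_laplacian G p u (val x) * u (val x)))%:E.
Proof.
move=> uO; rewrite energyE//; congr EFin.
pose S := \sum_(x <- N) \sum_(y <- N)
  omega G x y * signed_pow p (u y - u x) * u x.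
have SN : \sum_(x <- N) \sum_(y <- N)
    omega G x y * signed_pow p (u y - u x) * u y = - S.
  rewrite exchange_big/= /S -sumrN; apply: eq_bigr => x _.
  rewrite -sumrN; apply: eq_bigr => y _.
  by rewrite omega_sym -opprB signed_powN mulrN mulNr.
have -> : \sum_(x <- N) \sum_(y <- N) omega G x y * `|u y - u x| `^ p
    = - S - S.
  rewrite -{1}SN -sumrB; apply: eq_bigr => x _; rewrite -sumrB.
  by apply: eq_bigr => y _; rewrite -mulrBr -mulrA signed_pow_mulr// mulrA.
have -> : 2^-1 * (- S - S) = - S by field.
have -> : S = \sum_(x <- Omega) \sum_(y <- N)
    omega G x y * signed_pow p (u y - u x) * u x.
  apply/esym/big_fset_incl => [|x _ xO].
    by apply/fsubsetP => x; exact: starN.1.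
  by rewrite big1// => y _; rewrite (uO x)// mulr0.
rewrite big_seq_fsetE/= -sumrN; apply: eq_bigr => x _.
by rewrite -mulr_suml -p_laplacianE ?fsvalP// mulNr mulrN mulrA.
Qed.

End FiniteEnergy.

(** * Solutions, capacities and norms *)

Section Dirichlet.
Context {R : realType} {V : choiceType} {G : weighted_graph R V}.
Context {Omega : {fset V}} {p : R}.
Hypotheses (Gfin : locally_finite G) (p1 : 1 < p).

Lemma energy_ge0 u : (0 <= energy G p u)%E.
Proof.
apply: mule_ge0; first by rewrite lee_fin.
by apply: esum_ge0 => z _; rewrite lee_fin mulr_ge0 ?omega_ge0 ?powR_ge0.
Qed.

(** Testing the equation with the solution itself turns its energy into the
    integral of [w |u|^p], which grows when [w] is replaced by its positive part. *)
Lemma energy_solution_le {w : Omega -> R} {u} : dirichlet_solution G p w u ->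
  (energy G p u <=
   (\sum_(x : Omega) mu G (val x) * (pos_part w x * `|u (val x)| `^ p))%:E)%E.
Proof.
have [N starN] := closed_star_exists Omega Gfin.
move=> [uO eqn]; rewrite (green_formula starN p1)// lee_fin.
apply: ler_sum => x _; rewrite ler_wpM2l ?(ltW (mu_gt0 _ _))//.
rewrite eqn -mulrA signed_pow_mulr// ler_wpM2r ?powR_ge0//.
by rewrite /pos_part le_max lexx.
Qed.

(** The competitor is [u] normalized to take the value 1 at [x]. *)
Lemma point_capacity_le {u x} : X_V Omega u -> u x != 0 ->
  (point_capacity G p x Omega <= (`|(u x)^-1| `^ p)%:E * energy G p u)%E.
Proof.
have [N starN] := closed_star_exists Omega Gfin.
move=> uO ux0; rewrite -(energyZ starN p1)//; apply: ereal_inf_lbound.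
exists (fun y => (u x)^-1 * u y) => //; split; last by rewrite mulVf.
by move=> y yO; rewrite (uO y)// mulr0.
Qed.

Lemma point_capacity_ge0 x : (0 <= point_capacity G p x Omega)%E.
Proof. by apply/ereal_infP => _ [phi _ <-]; exact: energy_ge0. Qed.

Lemma lnorm_powR_gt0 (r : R) u x :
  x \in Omega -> u x != 0 ->
  0 < lnorm G r (fun y : Omega => u (val y)) `^ p.
Proof.
move=> xO ux0; do 2 apply: powR_gt0; rewrite (bigD1 [` xO]%fset)//=.
rewrite ltr_wpDr//; last by rewrite mulr_gt0 ?mu_gt0// powR_gt0 ?normr_gt0.
by apply: sumr_ge0 => y _; rewrite mulr_ge0 ?powR_ge0 ?(ltW (mu_gt0 _ _)).
Qed.

(** Hölder's inequality for the pair [f], [|g|^p]: the [s']-norm of [|g|^p] is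
    the [p]-th power of the [p s']-norm of [g]. *)
Lemma lnorm_hoelder {s : R} {f : Omega -> R} (g : Omega -> R) :
  1 < s -> (forall x, 0 <= f x) ->
  \sum_(x : Omega) mu G (val x) * (f x * `|g x| `^ p) <=
  lnorm G s f * lnorm G (p * conj_exponent s) g `^ p.
Proof.
move=> s1 f0; have s0 : 0 < s by exact: lt_trans s1.
have p0 : 0 < p by exact: lt_trans p1.
have st : s^-1 + (conj_exponent s)^-1 = 1.
  by rewrite /conj_exponent; field; rewrite subr_eq0 !gt_eqF.
have : 0 < conj_exponent s by rewrite divr_gt0// subr_gt0.
move: (conj_exponent s) st => t st t0.
have mu0 (x : Omega) : 0 <= mu G (val x) by rewrite ltW ?mu_gt0.
have g0 (x : Omega) : 0 <= `|g x| `^ p by exact: powR_ge0.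
apply: le_trans (hoelder_sum mu0 f0 g0 s0 t0 st) _.
rewrite /lnorm -[in leRHS]powRrM.
have -> : (p * t)^-1 * p = t^-1 by field; rewrite !gt_eqF.
under [in leRHS]eq_bigr do rewrite (ger0_norm (f0 _)).
by under [X in _ * X `^ _ <= _]eq_bigr do rewrite -powRrM.
Qed.

End Dirichlet.

(** * Reciprocals of capacitary radii *)

(** Taking reciprocals in the extended reals, where the reciprocal of 0 is
    [+oo]: a vanishing [e] forces [c] to be infinite, and the bound is then
    trivial. *)
Lemma div1e_le (R : realType) (c e r : \bar R) :
  (0 <= e -> e <= r -> e^-1 <= c -> 1 / c <= r)%E.
Proof.
move=> e0 er ec; rewrite div1e; apply: le_trans er.
have ei0 : (0 <= e^-1)%E by rewrite inve_ge0.
by rewrite -(inveK e) lee_pV2 // inE// (le_trans ei0).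
Qed.

(** At the two degenerate values of [e] both sides agree by convention: they are
    [+oo] when [e] is 0, and 0 when [e] is [+oo]. *)
Lemma inve_div (R : realType) (e : \bar R) (m : R) :
  (0 <= e)%E -> 0 < m -> ((e / m%:E)^-1 = m%:E / e)%E.
Proof.
move=> e0 m0; rewrite inveM ?inveK 1?muleC//.
rewrite inver gt_eqF// /inveM_def; case: e e0 => [r||]//= _.
  by rewrite invr_ge0 (ltW m0) implybT invr_eq0 gt_eqF.
by rewrite invr_gt0.
Qed.

Theorem theorem3p1 (R : realType) (V : choiceType) (G : weighted_graph R V)
    (Gconn : graph_connected G) (Gfin : locally_finite G)
    (Omega : {fset V}) (Omega_neq0 : Omega != fset0)
    (p : R) (p_gt1 : 1 < p) (w : Omega -> R)
    (sol : exists u : V -> R,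
       dirichlet_solution G p w u /\ exists x, u x != 0) :
  ((1 / cap_radius G p Omega)%E <= (lnorm G 1 (pos_part w))%:E)%E /\
  (forall s : R, 1 < s ->
     ((1 / cap_radius_s G p s Omega)%E <= (lnorm G s (pos_part w))%:E)%E).
Proof.
have [u [usol [z uz0]]] := sol; have [uO _] := usol.
have zO : z \in Omega by apply: contraNT uz0 => /uO ->.
have w0 x : 0 <= pos_part w x by rewrite /pos_part le_max lexx orbT.
have Eu := energy_solution_le Gfin p_gt1 usol.
split=> [|s s1].
  pose o := [arg max_(x > [` zO]%fset) `|u (val x)|]%O.
  have omax (x : Omega) : `|u (val x)| <= `|u (val o)|.
    by rewrite /o; case: arg_maxP => //= i _; apply.
  have uo0 : 0 < `|u (val o)|.
    by apply: lt_le_trans (omax [` zO]%fset); rewrite normr_gt0.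
  apply: (@div1e_le _ _ (point_capacity G p (val o) Omega)).
  - exact: point_capacity_ge0.
  - apply: le_trans (point_capacity_le Gfin p_gt1 uO _) _.
      by rewrite -normr_gt0.
    apply: le_trans (lee_wpmul2l _ Eu) _; first by rewrite lee_fin powR_ge0.
    rewrite -EFinM lee_fin /lnorm invr1 powRr1; last first.
      by apply: sumr_ge0 => x _; rewrite mulr_ge0 ?powR_ge0// ltW ?mu_gt0.
    rewrite mulr_sumr; apply: ler_sum => x _.
    rewrite powRr1// (ger0_norm (w0 x)) mulrCA ler_wpM2l ?(ltW (mu_gt0 _ _))//.
    rewrite mulrCA ler_piMr// -powRM//.
    have -> : 1 = 1 `^ p :> R by rewrite powR1.
    rewrite ge0_ler_powR ?nnegrE ?mulr_ge0 ?(ltW (lt_trans ltr01 p_gt1))//.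
    by rewrite normfV mulrC ler_pdivrMr// mul1r.
  - by apply: le_bigmax.
have m0 := @lnorm_powR_gt0 _ _ G _ p (p * conj_exponent s) u z zO uz0.
set m := (X in 0 < X) in m0.
apply: (@div1e_le _ _ (energy G p u / m%:E)%E).
- by rewrite mule_ge0 ?energy_ge0// inve_ge0 lee_fin ltW.
- rewrite inver gt_eqF// lee_pdivrMr// -EFinM; apply: le_trans Eu _.
  by rewrite lee_fin lnorm_hoelder.
apply: ereal_sup_ubound; exists u; first by split=> //; exists z.
by rewrite inve_div ?energy_ge0.
Qed.
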